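(* (Effective Glivenko's theorem.) Let $\{\varphi_m\}$ be a computable sequence of characteristic functions and $\varphi$ a characteristic function, and let $\{\mu_m\}$ and $\mu$ be the corresponding probability distributions on $\mathbb{R}$. If $\{\varphi_m\}$ converges effectively to $\varphi$, then $\{\mu_m\}$ converges effectively to $\mu$.
   Context: A probability distribution is a Borel probability measure $\mu$ on $\mathbb{R}$; $\mu(f)=\int f\,d\mu$; its characteristic function is $\varphi(t)=\int_{\mathbb{R}} e^{itx}\mu(dx)$. Computability of functions is in the sense of Pour-El and Richards: a sequence of real functions $\{f_n\}$ is computable if (i) for every computable sequence of reals $\{x_j\}$, $\{f_n(x_j)\}$ is a computable double sequence, and (ii) there is a recursive $\alpha(n,L,k)$ with $|x-y|<2^{-\alpha(n,L,k)}$, $|x|,|y|\le L$ implying $|f_n(x)-f_n(y)|<2^{-k}$; a sequence of complex-valued functions is computable iff the sequences of real parts and of imaginary parts are computable. A sequence of functions $\{\varphi_m\}$ converges effectively to $\varphi$ if there is a recursive $\alpha(L,k)$ such that $m\ge \alpha(L,k)$ and $|t|\le L$ imply $|\varphi_m(t)-\varphi(t)|<2^{-k}$. $\{f_n\}$ is computable with compact support if it is computable and there is a recursive $L(n)$ with $f_n(x)=0$ for $|x|\ge L(n)$. $\{\mu_m\}$ converges effectively to $\mu$ if for every computable sequence of real functions $\{f_n\}$ with compact support there is a recursive $\beta(n,k)$ with $|\mu_m(f_n)-\mu(f_n)|<2^{-k}$ whenever $m\ge\beta(n,k)$. *)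

(* Defs.v *)
From mathcomp Require Import all_boot all_order all_algebra.
From mathcomp Require Import complex.
From mathcomp Require Import all_classical all_reals all_analysis.

Set Implicit Arguments.
Unset Strict Implicit.
Unset Printing Implicit Defensive.

Import Order.TTheory GRing.Theory Num.Theory.

Local Open Scope ring_scope.

(* Total (general) recursive functions: minimization is applied only to
   functions that have a zero in the minimized (first) argument for all values
   of the others.  Primitive recursion and minimization are given by their
   defining equations, with the recursion variable as first argument. *)
Inductive recursive : forall k : nat, (k.-tuple nat -> nat) -> Prop :=
| recursive_zero :
    recursive (fun _ : 0.-tuple nat => 0%N)
| recursive_succ :
    recursive (fun v : 1.-tuple nat => (thead v).+1)
| recursive_proj (k : nat) (i : 'I_k) :
    recursive (fun v : k.-tuple nat => tnth v i)
| recursive_comp (k l : nat) (g : l.-tuple nat -> nat)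
    (h : 'I_l -> k.-tuple nat -> nat) :
    recursive g -> (forall i, recursive (h i)) ->
    recursive (fun v : k.-tuple nat => g [tuple h i v | i < l])
| recursive_primrec (k : nat) (g : k.-tuple nat -> nat)
    (h : k.+2.-tuple nat -> nat) (f : k.+1.-tuple nat -> nat) :
    recursive g -> recursive h ->
    (forall v : k.-tuple nat, f [tuple of 0%N :: v] = g v) ->
    (forall (n : nat) (v : k.-tuple nat),
      f [tuple of n.+1 :: v] = h [tuple of n :: f [tuple of n :: v] :: v]) ->
    recursive f
| recursive_min (k : nat) (g : k.+1.-tuple nat -> nat) (f : k.-tuple nat -> nat) :
    recursive g ->
    (forall v : k.-tuple nat, g [tuple of f v :: v] = 0%N) ->
    (forall (v : k.-tuple nat) (m : nat),
      (m < f v)%N -> g [tuple of m :: v] <> 0%N) ->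
    recursive f.

Definition computable_rat_seq (k : nat) (r : k.-tuple nat -> rat) : Prop :=
  exists a b s : k.-tuple nat -> nat,
    [/\ recursive a, recursive b, recursive s, (forall v, b v <> 0%N) &
        forall v, r v = (-1) ^+ s v * ((a v)%:R / (b v)%:R)].

Section Computability.
Variable R : realType.

(* The approximation index is the first argument of [r], and the precision is
   the first argument of the modulus [e]. *)
Definition computable_real_seq (k : nat) (x : k.-tuple nat -> R) : Prop :=
  exists r : k.+1.-tuple nat -> rat, exists e : k.+1.-tuple nat -> nat,
    [/\ computable_rat_seq r, recursive e &
        forall (N : nat) (v : k.-tuple nat) (n : nat),
          (e [tuple of N :: v] <= n)%N ->
          `|ratr (r [tuple of n :: v]) - x v| <= 2 ^- N].

Definition sequentially_computable (f : nat -> R -> R) : Prop :=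
  forall x : nat -> R,
    computable_real_seq (fun v : 1.-tuple nat => x (thead v)) ->
    computable_real_seq
      (fun v : 2.-tuple nat => f (tnth v ord0) (x (tnth v ord_max))).

Definition effectively_uniformly_continuous (f : nat -> R -> R) : Prop :=
  exists2 alpha : 3.-tuple nat -> nat, recursive alpha &
    forall (n L k : nat) (x y : R),
      `|x - y| < 2 ^- alpha [tuple n; L; k] -> `|x| <= L%:R -> `|y| <= L%:R ->
      `|f n x - f n y| < 2 ^- k.

Definition computable_fun_seq (f : nat -> R -> R) : Prop :=
  sequentially_computable f /\ effectively_uniformly_continuous f.

Definition computable_cfun_seq (f : nat -> R -> R[i]) : Prop :=
  computable_fun_seq (fun n t => complex.Re (f n t)) /\
  computable_fun_seq (fun n t => complex.Im (f n t)).

Definition computable_compact_support (f : nat -> R -> R) : Prop :=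
  computable_fun_seq f /\
  exists2 L : 1.-tuple nat -> nat, recursive L &
    forall (n : nat) (x : R), (L [tuple n])%:R <= `|x| -> f n x = 0.

(* `|z| is an element of R[i] (with zero imaginary part), so the final bound is
   an inequality in R[i]; it amounts to the same inequality between reals. *)
Definition effective_cvg_cfun (phi_ : nat -> R -> R[i]) (phi : R -> R[i]) :
    Prop :=
  exists2 alpha : 2.-tuple nat -> nat, recursive alpha &
    forall (L k m : nat) (t : R),
      (alpha [tuple L; k] <= m)%N -> `|t| <= L%:R ->
      `|phi_ m t - phi t| < 2 ^- k.

Definition expi (y : R) : R[i] := Complex (cos y) (sin y).

Definition cintegral (mu : probability (measurableTypeR R) R)
    (g : R -> R[i]) : R[i] :=
  Complex (\int[mu]_x complex.Re (g x)) (\int[mu]_x complex.Im (g x)).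

Definition char_fun (mu : probability (measurableTypeR R) R) (t : R) : R[i] :=
  cintegral mu (fun x => expi (t * x)).

Definition effective_cvg_distribution
    (mu_ : nat -> probability (measurableTypeR R) R)
    (mu : probability (measurableTypeR R) R) : Prop :=
  forall f : nat -> R -> R, computable_compact_support f ->
    exists2 beta : 2.-tuple nat -> nat, recursive beta &
      forall n k m : nat, (beta [tuple n; k] <= m)%N ->
        `|\int[mu_ m]_x f n x - \int[mu]_x f n x| < 2 ^- k.

End Computability.

(* Main.v *)
(** The test functions are approximated by trigonometric polynomials that are
    discrete averages of samples: with [F] the Fejer kernel of order [N] and
    [2 N] equispaced nodes [y_j] filling one period, put
    [g(x) = sum_j f(y_j) F(v_j)^2 / Z], where [v_j] is the angle from [y_j] to
    [x].  As [F^2] has degree less than [2 N], the normalization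
    [Z = sum_j F(v_j)^2] does not depend on [x], so the integral of [g] is a
    combination of values of the characteristic function.  The frequencies of
    [g] and the number of nodes in the support of [f] depend only on the mesh,
    not on the period: fixing the mesh and letting the period tend to infinity
    (for a fixed index [m]) removes the tails of the two measures, and what
    remains is an explicit bound in terms of the modulus of continuity and the
    support of [f]. *)

Require Import Defs.
From mathcomp Require Import all_boot all_order all_algebra.
From mathcomp Require Import ring lra zify.
From mathcomp Require Import complex.
From mathcomp Require Import all_classical all_reals all_analysis.
From mathcomp Require Import measurable_realfun.

Set Implicit Arguments.
Unset Strict Implicit.
Unset Printing Implicit Defensive.

Import Order.TTheory GRing.Theory Num.Theory.
Import numFieldNormedType.Exports.

Local Open Scope ring_scope.

(** * The Fejer kernel and its sums over equispaced angles *)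

Section Fejer.
Variable R : realType.
Implicit Types (N M : nat) (u w x : R).

Definition cos_sum N u : R := \sum_(k < N) cos (k%:R * u).
Definition sin_sum N u : R := \sum_(k < N) sin (k%:R * u).
(* [| sum_(k < N) e^(i k u) |^2] *)
Definition fejer N u : R := cos_sum N u ^+ 2 + sin_sum N u ^+ 2.

Lemma fejer_ge0 N u : 0 <= fejer N u.
Proof. by rewrite addr_ge0 ?sqr_ge0. Qed.

Lemma fejer0 N : fejer N 0 = N%:R ^+ 2.
Proof.
rewrite /fejer /cos_sum /sin_sum.
under eq_bigr do rewrite mulr0 cos0.
under [X in _ + X ^+ 2]eq_bigr do rewrite mulr0 sin0.
by rewrite big1_eq expr0n addr0 sumr_const card_ord.
Qed.

(* Real and imaginary parts of the geometric sum
   [(1 - z) (1 + z + ... + z^(N-1)) = 1 - z^N] at [z = e^(iu)]. *)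
Lemma cos_sum_geom N u :
  cos_sum N u * (1 - cos u) + sin_sum N u * sin u = 1 - cos (N%:R * u).
Proof.
elim: N => [|N IH]; first by rewrite /cos_sum /sin_sum !big_ord0 !mul0r cos0; ring.
rewrite /cos_sum /sin_sum !big_ord_recr/= -/(cos_sum N u) -/(sin_sum N u).
have -> : N.+1%:R * u = N%:R * u + u by rewrite -natr1; ring.
rewrite cosD; lra.
Qed.

Lemma sin_sum_geom N u :
  sin_sum N u * (1 - cos u) - cos_sum N u * sin u = - sin (N%:R * u).
Proof.
elim: N => [|N IH]; first by rewrite /cos_sum /sin_sum !big_ord0 !mul0r sin0; ring.
rewrite /cos_sum /sin_sum !big_ord_recr/= -/(cos_sum N u) -/(sin_sum N u).
have -> : N.+1%:R * u = N%:R * u + u by rewrite -natr1; ring.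
rewrite sinD; lra.
Qed.

(** Squared moduli in the geometric sum identity: [|1 - e^(iu)|^2 = 2 (1 - cos u)], likewise at
    [N u], and the factor 2 cancels. *)
Lemma fejer_1Bcos N u : fejer N u * (1 - cos u) = 1 - cos (N%:R * u).
Proof.
have h1 := cos_sum_geom N u; have h2 := sin_sum_geom N u.
have c1 := cos2Dsin2 u; have c2 := cos2Dsin2 (N%:R * u).
have e1 : (1 - cos u) ^+ 2 + sin u ^+ 2 = 2 * (1 - cos u) by lra.
have e2 : (1 - cos (N%:R * u)) ^+ 2 + sin (N%:R * u) ^+ 2
   = 2 * (1 - cos (N%:R * u)) by lra.
apply: (mulfI (x := 2)); first by rewrite pnatr_eq0.
rewrite -e2 mulrCA -e1 -h1 -[X in _ = _ + X]sqrrN -h2 /fejer; ring.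
Qed.

(** Frequencies are listed with repetition, one for each pair of exponents, so that every cosine in
    the expansion has coefficient 1. *)
Definition freq N (p : 'I_N * 'I_N) : int := (p.1 : nat)%:Z - (p.2 : nat)%:Z.
Definition freq2 N (q : ('I_N * 'I_N) * ('I_N * 'I_N)) : int :=
  freq q.1 + freq q.2.

Lemma fejerE N u :
  fejer N u = \sum_(p : 'I_N * 'I_N) cos ((freq p)%:~R * u).
Proof.
rewrite /fejer !expr2 /cos_sum /sin_sum !big_distrlr/= !pair_bigA -big_split/=.
apply: eq_bigr => -[k l] _ /=.
by rewrite /freq/= rmorphB/= mulrBl cosB.
Qed.

(** Exchanging the two members of a pair negates its frequency, so the sines cancel. This removes
    the sine products when the kernel is squared. *)
Lemma sum_sin_freq N u :
  \sum_(p : 'I_N * 'I_N) sin ((freq p)%:~R * u) = 0.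
Proof.
under eq_bigr => p _ do rewrite /freq rmorphB/= mulrBl sinB.
rewrite sumrB.
rewrite -(pair_bigA _ (fun k l : 'I_N =>
  sin ((k : nat)%:~R * u) * cos ((l : nat)%:~R * u)))/=.
rewrite -(pair_bigA _ (fun k l : 'I_N =>
  cos ((k : nat)%:~R * u) * sin ((l : nat)%:~R * u)))/=.
by rewrite exchange_big/=; under eq_bigr do under eq_bigr do rewrite mulrC;
  rewrite subrr.
Qed.

Lemma fejer_sqrE N u : fejer N u ^+ 2 =
  \sum_(q : ('I_N * 'I_N) * ('I_N * 'I_N)) cos ((freq2 q)%:~R * u).
Proof.
under eq_bigr => q _ do rewrite /freq2 rmorphD/= mulrDl cosD.
rewrite sumrB -(pair_bigA _ (fun p p' : 'I_N * 'I_N =>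
  cos ((freq p)%:~R * u) * cos ((freq p')%:~R * u)))/=.
rewrite -(pair_bigA _ (fun p p' : 'I_N * 'I_N =>
  sin ((freq p)%:~R * u) * sin ((freq p')%:~R * u)))/=.
by rewrite -!big_distrlr/= sum_sin_freq mul0r subr0 -fejerE expr2.
Qed.

Lemma freq_lt N (p : 'I_N * 'I_N) : (`|freq p| < N)%N.
Proof. by case: p => k l; rewrite /freq/=; have := ltn_ord k; have := ltn_ord l; lia. Qed.

Lemma freq2_lt N (q : ('I_N * 'I_N) * ('I_N * 'I_N)) : (`|freq2 q| < N.*2)%N.
Proof.
by case: q => p p'; rewrite /freq2/=; have := freq_lt p; have := freq_lt p'; lia.
Qed.

Lemma freq_eq0 N (p : 'I_N * 'I_N) : (freq p == 0) = (p.1 == p.2).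
Proof. by rewrite /freq subr_eq0. Qed.

Lemma cosN1_lt2pi u : 0 < u < 2 * pi -> cos u != 1.
Proof.
move=> /andP[u0 u2].
have : 0 < sin (u / 2) by apply: sin_gt0_pi; lra.
have -> : cos u = 1 - 2 * sin (u / 2) ^+ 2.
  have /(congr1 (@cos R)) -> : u = (u / 2) *+ 2 by rewrite mulr2n; lra.
  by rewrite cos_mulr2n mulr2n; have := cos2Dsin2 (u / 2); lra.
by move=> s0; apply/eqP => h; nra.
Qed.

Lemma cosD2piz u (a : int) : cos (u + a%:~R * (2 * pi)) = cos u.
Proof.
have h n v : cos (v + n%:R * (2 * pi)) = cos v :> R.
  by rewrite -[RHS](periodicn (@cosD2pi R) n) mulr_natl mulr_natl.
case: (intP a) => [|n|n]; first by rewrite mul0r addr0.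
  exact: h.
rewrite -[LHS](h n.+1); congr cos; rewrite rmorphN/=; lra.
Qed.

(** Orthogonality of characters: for the step [u = 2 pi a / M] the product [fejer M u * (1 - cos u)]
    is [1 - cos (2 pi a) = 0]. If [0 < |a| < M] then [cos u != 1], so the kernel vanishes at [u],
    and with it both the cosine and the sine sum. *)
Lemma sum_cos_equispaced M (a : int) w : (`|a| < M)%N ->
  \sum_(j < M) cos (a%:~R * (w - j%:R * (2 * pi / M%:R))) =
  if a == 0 then M%:R else 0.
Proof.
move=> aM; have M0 : M%:R != 0 :> R by rewrite pnatr_eq0; lia.
have [->|a0] := eqVneq.
  by under eq_bigr do rewrite mul0r cos0; rewrite sumr_const card_ord.
set u : R := a%:~R * (2 * pi / M%:R).
have cosu : cos u != 1.
  (* As cosine is even, [a] may be replaced by its absolute value, which puts the angle in (0, 2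
     pi). *)
  have -> : cos u = cos (`|a|%:R * (2 * pi / M%:R)).
    by rewrite -cos_norm /u normrM -intr_norm (ger0_norm (_ : 0 <= 2 * pi / M%:R))
      // ?divr_ge0 ?mulr_ge0 ?pi_ge0 // -abszE.
  apply: cosN1_lt2pi; rewrite mulrCA.
  have pi0 := @pi_gt0 R; have Mp : 0 < M%:R :> R by rewrite ltr0n; lia.
  apply/andP; split.
    by rewrite !mulr_gt0 ?invr_gt0 // ltr0n absz_gt0.
  by rewrite gtr_pMr ?mulr_gt0// ltr_pdivrMr// mul1r ltr_nat.
have : fejer M u = 0.
  have : fejer M u * (1 - cos u) = 0.
    rewrite fejer_1Bcos.
    have -> : M%:R * u = 0 + a%:~R * (2 * pi) by rewrite /u; field.
    by rewrite cosD2piz cos0 subrr.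
  by move/eqP; rewrite mulf_eq0 subr_eq0 [1 == _]eq_sym (negbTE cosu) orbF => /eqP.
move/eqP; rewrite paddr_eq0 ?sqr_ge0// !sqrf_eq0 => /andP[/eqP C0 /eqP S0].
under eq_bigr => j _.
  rewrite mulrBr mulrCA -/u cosB; over.
by rewrite big_split/= -!mulr_sumr -/(cos_sum M u) -/(sin_sum M u) C0 S0 !mulr0 addr0.
Qed.

Lemma sum_cos_freq_equispaced (I : finType) (a : I -> int) M w :
  (forall i, (`|a i| < M)%N) ->
  \sum_(j < M) \sum_i cos ((a i)%:~R * (w - j%:R * (2 * pi / M%:R))) =
  M%:R * #|[set i | a i == 0]|%:R.
Proof.
move=> aM; rewrite exchange_big/=.
under eq_bigr => i _ do rewrite sum_cos_equispaced//.
by rewrite -big_mkcond/= sumr_const cardsE mulr_natr.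
Qed.

Lemma sum_fejer N w :
  \sum_(j < N.*2) fejer N (w - j%:R * (2 * pi / N.*2%:R)) = N.*2%:R * N%:R.
Proof.
under eq_bigr do rewrite fejerE.
rewrite sum_cos_freq_equispaced => [|p]; last by have := freq_lt p; lia.
congr (_ * _%:R).
rewrite (_ : [set _ | _] = [set (k, k) | k : 'I_N]).
  by rewrite card_imset ?card_ord// => k l [].
apply/setP => -[k l]; rewrite inE freq_eq0/=.
apply/eqP/imsetP => [->|[i _ [-> ->]]//].
by exists l.
Qed.

(** The cardinal counts the constant terms of [fejer N u ^+ 2], the only ones that survive summation
    over the nodes. *)
Definition jackson_mass N : R :=
  N.*2%:R * #|[set q : ('I_N * 'I_N) * ('I_N * 'I_N) | freq2 q == 0]|%:R.

Lemma sum_fejer_sqr N w :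
  \sum_(j < N.*2) fejer N (w - j%:R * (2 * pi / N.*2%:R)) ^+ 2 = jackson_mass N.
Proof.
under eq_bigr do rewrite fejer_sqrE.
by rewrite sum_cos_freq_equispaced// => q; exact: freq2_lt.
Qed.

(** The mass may be computed at any base angle; at 0, the node [j = 0] alone contributes
    [fejer N 0 ^+ 2], which is [N^4]. *)
Lemma jackson_mass_ge N : (0 < N)%N -> N%:R ^+ 4 <= jackson_mass N.
Proof.
move=> N0; rewrite -(sum_fejer_sqr N 0).
have N20 : (0 < N.*2)%N by lia.
rewrite (bigD1 (Ordinal N20))//= mul0r subr0 fejer0 -exprM lerDl.
by apply: sumr_ge0 => j _; rewrite sqr_ge0.
Qed.

End Fejer.

(** * Approximation by sampled trigonometric polynomials *)

Section Jackson.
Variable R : realType.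
Implicit Types (N M : nat) (u v w x : R).

Lemma fejer_le N u : fejer N u <= N%:R ^+ 2.
Proof.
rewrite fejerE (le_trans (ler_sum _ (fun p _ => cos_le1 _)))//.
by rewrite sumr_const card_prod card_ord natrM expr2.
Qed.

(** At [pi / M] the product of the kernel with [1 - cos] is [1 - cos pi = 2], and the kernel is at
    most [M^2]. *)
Lemma onemcos_pi_div_ge M : (0 < M)%N -> 2 <= M%:R ^+ 2 * (1 - cos (pi / M%:R) : R).
Proof.
move=> M0; have <- : fejer M (pi / M%:R) * (1 - cos (pi / M%:R)) = 2 :> R.
  by rewrite fejer_1Bcos mulrC divfK ?pnatr_eq0 -?lt0n// cospi; lra.
by rewrite ler_wpM2r ?fejer_le// subr_ge0 cos_le1.
Qed.

(** Cosine decreases on [0, pi], and the reflection [v -> 2 pi - v] preserves both cosine and the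
    range of [|v|], so the endpoint [pi / M] is the worst case. *)
Lemma onemcos_ge M v : (0 < M)%N ->
  pi / M%:R <= `|v| -> `|v| <= 2 * pi - pi / M%:R ->
  2 <= M%:R ^+ 2 * (1 - cos v).
Proof.
move=> M0 v1 v2; apply: le_trans (onemcos_pi_div_ge M0) _.
have pi0 := @pi_gt0 R; have M1 : 1 <= M%:R :> R by rewrite ler1n.
have piM0 : 0 <= pi / M%:R :> R by rewrite divr_ge0 ?pi_ge0.
have piM : pi / M%:R <= pi :> R by rewrite ler_piMr ?pi_ge0// invf_le1 ?(lt_le_trans _ M1).
have mono y : pi / M%:R <= y <= pi -> cos y <= cos (pi / M%:R : R).
  move=> /andP[y1 y2]; rewrite le_eqVlt; move: y1; rewrite le_eqVlt => /predU1P[->|y1].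
    by rewrite eqxx.
  by rewrite ltr_cos ?y1 ?orbT// in_itv/=; apply/andP; split; lra.
rewrite ler_wpM2l ?sqr_ge0// lerD2l lerN2 -(cos_norm v).
have [vpi|vpi] := leP `|v| pi; first by apply: mono; rewrite v1.
rewrite -cosN -cosD2pi mulr2n; apply: mono; lra.
Qed.

Definition sample_angle N w (j : nat) : R := w - j%:R * (2 * pi / N.*2%:R).

Definition jackson_weight N w (j : nat) : R :=
  fejer N (sample_angle N w j) ^+ 2 / jackson_mass R N.

Lemma jackson_mass_gt0 N : (0 < N)%N -> 0 < jackson_mass R N.
Proof.
by move=> N0; rewrite (lt_le_trans _ (jackson_mass_ge R N0))// exprn_gt0 ?ltr0n.
Qed.

Lemma jackson_weight_ge0 N w j : 0 <= jackson_weight N w j.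
Proof. by rewrite divr_ge0 ?sqr_ge0// mulr_ge0. Qed.

Lemma sum_jackson_weight N w : (0 < N)%N ->
  \sum_(j < N.*2) jackson_weight N w j = 1.
Proof.
move=> N0; rewrite -mulr_suml sum_fejer_sqr divff//.
by rewrite gt_eqF ?jackson_mass_gt0.
Qed.

(* Since [(1 - cos v) F(v) = 1 - cos (N v) <= 2], one factor of the kernel is
   left, whose samples add up to [2 N^2], against a mass of at least [N^4]. *)
Lemma jackson_moment_le N w : (0 < N)%N ->
  \sum_(j < N.*2) (1 - cos (sample_angle N w j)) * jackson_weight N w j <=
  4 / N%:R ^+ 2.
Proof.
move=> N0; have N0R : 0 < N%:R :> R by rewrite ltr0n.
have Z0 := jackson_mass_gt0 N0.
have le1 (j : 'I_N.*2) : (1 - cos (sample_angle N w j)) * jackson_weight N w j <=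
    2 / jackson_mass R N * fejer N (sample_angle N w j).
  set v := sample_angle N w j.
  have -> : (1 - cos v) * jackson_weight N w j =
      (1 - cos (N%:R * v)) * (fejer N v / jackson_mass R N).
    by rewrite -fejer_1Bcos /jackson_weight -/v; ring.
  rewrite mulrAC -mulrA ler_wpM2r ?divr_ge0 ?fejer_ge0 ?(ltW Z0)//.
  by have := cos_geN1 (N%:R * v); lra.
apply: le_trans (ler_sum _ (fun j _ => le1 j)) _.
rewrite -mulr_sumr sum_fejer -mul2n natrM ler_pdivlMr ?exprn_gt0//.
have -> : 2 / jackson_mass R N * (2 * N%:R * N%:R) * N%:R ^+ 2 =
    (jackson_mass R N)^-1 * (4 * N%:R ^+ 4) by ring.
rewrite ler_pdivrMl//.
by have := jackson_mass_ge R N0; lra.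
Qed.

(** The weights are nonnegative with sum 1, so the error is an average of the [t - c j]: [eta] is
    kept, and the [1 - cos] part is the moment already bounded. *)
Lemma jackson_approx N w (t eta K : R) (c : nat -> R) : (0 < N)%N -> 0 <= K ->
  (forall j : 'I_N.*2, `|t - c j| <= eta + K * (1 - cos (sample_angle N w j))) ->
  `|t - \sum_(j < N.*2) c j * jackson_weight N w j| <= eta + 4 * K / N%:R ^+ 2.
Proof.
move=> N0 K0 tc.
have -> : t - \sum_(j < N.*2) c j * jackson_weight N w j =
    \sum_(j < N.*2) (t - c j) * jackson_weight N w j.
  rewrite -[t in LHS]mulr1 -(sum_jackson_weight w N0) mulr_sumr -sumrB.
  by apply: eq_bigr => j _; rewrite mulrBl.
apply: le_trans (ler_norm_sum _ _ _) _.
have le1 (j : 'I_N.*2) : `|(t - c j) * jackson_weight N w j| <=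
  eta * jackson_weight N w j +
  K * ((1 - cos (sample_angle N w j)) * jackson_weight N w j).
  rewrite normrM (ger0_norm (jackson_weight_ge0 _ _ _)) [K * _]mulrA -mulrDl.
  by rewrite ler_wpM2r ?jackson_weight_ge0.
apply: le_trans (ler_sum _ (fun j _ => le1 j)) _.
rewrite big_split/= -!mulr_sumr sum_jackson_weight// mulr1 lerD2l.
rewrite [4 * K]mulrC -mulrA ler_wpM2l//; exact: jackson_moment_le.
Qed.

(* Nodes [y_j = (j - D M) delta / D], of spacing [delta / D], filling one period
   [-M delta, M delta). *)
Definition node (D M : nat) (delta : R) (j : nat) : R :=
  (j%:R - (D * M)%:R) * (delta / D%:R).

(** Affine map of the period [-M delta, M delta] onto [0, 2 pi]; the shift by [pi] puts the leftmost
    node at angle 0. *)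
Definition phase (M : nat) (delta x : R) : R := pi / (M%:R * delta) * x + pi.

Lemma sample_angle_node D M delta x j : (0 < D)%N -> (0 < M)%N -> 0 < delta ->
  sample_angle (D * M) (phase M delta x) j =
  pi / (M%:R * delta) * (x - node D M delta j).
Proof.
move=> D0 M0 d0; rewrite /sample_angle /phase /node -mul2n !natrM; field.
by rewrite !pnatr_eq0 -!lt0n D0 M0 gt_eqF.
Qed.

Definition jackson (f : R -> R) (D M : nat) (delta x : R) : R :=
  \sum_(j < (D * M).*2) f (node D M delta j) * jackson_weight (D * M) (phase M delta x) j.

Lemma jackson_bound (f : R -> R) (D M : nat) (delta B x : R) : (0 < D)%N -> (0 < M)%N ->
  (forall y, `|f y| <= B) -> `|jackson f D M delta x| <= B.
Proof.
move=> D0 M0 fB; apply: le_trans (ler_norm_sum _ _ _) _.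
rewrite -[B]mulr1 -(sum_jackson_weight (phase M delta x) (_ : 0 < D * M)%N) ?muln_gt0 ?D0//.
rewrite mulr_sumr ler_sum// => j _.
by rewrite normrM (ger0_norm (jackson_weight_ge0 _ _ _)) ler_wpM2r ?jackson_weight_ge0.
Qed.

(** Nodes within [delta] of [x] are handled by the modulus of continuity. At the others the
    difference is at most [2 B], which [B * M^2 * (1 - cos)] dominates; dividing the moment by
    [(D M)^2] cancels [M^2]. *)
Lemma jackson_error (f : R -> R) (D M : nat) (delta B L eta x : R) :
  (0 < D)%N -> (0 < M)%N -> 0 < delta ->
  (forall y, `|f y| <= B) -> (forall y, L <= `|y| -> f y = 0) ->
  (forall y z, `|y - z| < delta -> `|f y - f z| <= eta) ->
  L <= M%:R * delta - delta -> `|x| <= M%:R * delta ->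
  `|f x - jackson f D M delta x| <= eta + 4 * B / D%:R ^+ 2.
Proof.
move=> D0 M0 d0 fB f0 fmod LM xM.
have DM0 : (0 < D * M)%N by rewrite muln_gt0 D0.
have B0 : 0 <= B by rewrite (le_trans _ (fB 0)).
have eta0 : 0 <= eta by rewrite (le_trans _ (fmod 0 0 _))// subrr normr0.
have M0R : 0 < M%:R :> R by rewrite ltr0n.
have D0R : 0 < D%:R :> R by rewrite ltr0n.
have -> : 4 * B / D%:R ^+ 2 = 4 * (B * M%:R ^+ 2) / (D * M)%:R ^+ 2.
  by rewrite natrM; field; rewrite !gt_eqF.
apply: (jackson_approx (c := fun j => f (node D M delta j))) => //.
  by rewrite mulr_ge0 ?sqr_ge0.
move=> j; rewrite sample_angle_node//; set y := node D M delta j.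
have cos1 := cos_le1 (pi / (M%:R * delta) * (x - y)).
have rhs0 : 0 <= B * M%:R ^+ 2 * (1 - cos (pi / (M%:R * delta) * (x - y))).
  by rewrite !mulr_ge0 ?sqr_ge0// subr_ge0.
have yM : `|y| <= M%:R * delta.
  rewrite /y /node normrM (ger0_norm (_ : 0 <= delta / D%:R)) ?divr_ge0 ?(ltW d0)//.
  have -> : M%:R * delta = (D * M)%:R * (delta / D%:R).
    by rewrite natrM; field; rewrite gt_eqF.
  rewrite ler_wpM2r ?divr_ge0 ?(ltW d0)// ler_distl subrr ler0n -natrD ler_nat.
  by have := ltn_ord j; rewrite addnn => /ltnW.
have [xy|xy] := ltP `|x - y| delta.
  by have := fmod _ _ xy; lra.
(* Nodes close to [x] only modulo the period: then [x] and [y] lie near opposite ends of the period,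
   outside the support, and both values are 0. *)
have [xy2|xy2] := leP `|x - y| (2 * (M%:R * delta) - delta); last first.
  have trixy := ler_normB x y.
  by rewrite (f0 x) ?(f0 y) ?subrr ?normr0; lra.
have far : 2 <= M%:R ^+ 2 * (1 - cos (pi / (M%:R * delta) * (x - y))).
  have pi0 := @pi_gt0 R.
  have c0 : 0 < pi / (M%:R * delta) by rewrite divr_gt0 ?mulr_gt0.
  have e1 : pi / M%:R = pi / (M%:R * delta) * delta by field; rewrite !gt_eqF.
  have e2 : 2 * pi - pi / M%:R = pi / (M%:R * delta) * (2 * (M%:R * delta) - delta).
    by field; rewrite !gt_eqF.
  by apply: onemcos_ge => //; rewrite normrM (gtr0_norm c0) ?e2 ?e1 ler_wpM2l// ltW.
have := ler_normB (f x) (f y); have := fB x; have := fB y.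
rewrite -mulrA; nra.
Qed.

Definition jackson_index N :=
  ('I_N.*2 * (('I_N * 'I_N) * ('I_N * 'I_N)))%type.

Definition jackson_freq (D M : nat) (delta : R) (i : jackson_index (D * M)) : R :=
  (freq2 i.2)%:~R * (pi / (M%:R * delta)).

Lemma jacksonE (f : R -> R) (D M : nat) (delta x : R) :
  (0 < D)%N -> (0 < M)%N -> 0 < delta ->
  jackson f D M delta x = \sum_(i : jackson_index (D * M))
    f (node D M delta i.1) / jackson_mass R (D * M) *
    cos (jackson_freq delta i * x - jackson_freq delta i * node D M delta i.1).
Proof.
move=> D0 M0 d0; rewrite /jackson.
under eq_bigr => j _.
  rewrite /jackson_weight fejer_sqrE sample_angle_node// mulrCA mulrC mulr_sumr.
  over.
rewrite pair_bigA/=; apply: eq_bigr => i _.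
by rewrite /jackson_freq -mulrBr mulrA.
Qed.

(** The factor [M] in the degree cancels against the period, so the same range of frequencies serves
    for every [M]. The constant 8 comes from degree below [2 D M] and [pi <= 4]. *)
Lemma jackson_freq_le D M delta i : (0 < D)%N -> (0 < M)%N -> 0 < delta ->
  `|@jackson_freq D M delta i| <= 8 * D%:R / delta.
Proof.
move=> D0 M0 d0; have M0R : 0 < M%:R :> R by rewrite ltr0n.
rewrite /jackson_freq normrM -intr_norm -abszE.
rewrite (gtr0_norm (_ : 0 < pi / (M%:R * delta))) ?divr_gt0 ?mulr_gt0 ?pi_gt0//.
have q2 : `|freq2 i.2|%:R <= 2 * (D%:R * M%:R) :> R.
  by rewrite -!natrM ler_nat mul2n ltnW// freq2_lt.
have p4 : pi <= 4 :> R by have := @pihalf_lt2 R; lra.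
rewrite mulrA ler_pdivrMr ?mulr_gt0//.
have -> : 8 * D%:R / delta * (M%:R * delta) = 2 * (D%:R * M%:R) * 4.
  by field; rewrite gt_eqF.
by rewrite ler_pM ?pi_ge0.
Qed.

(** Only indices at distance less than [C] from the central index [D * M] can meet the support, and
    these lie in an interval of [C.*2] integers, whatever [M] is. *)
Lemma sum_node_le (f : R -> R) (D M C : nat) (delta B : R) :
  (0 < D)%N -> 0 < delta -> (forall y, `|f y| <= B) ->
  (forall y, C%:R * (delta / D%:R) <= `|y| -> f y = 0) ->
  \sum_(j < (D * M).*2) `|f (node D M delta j)| <= B * (C.*2)%:R.
Proof.
move=> D0 d0 fB f0; set N := (D * M)%N.
have D0R : 0 < D%:R :> R by rewrite ltr0n.
pose A := [set j : 'I_N.*2 | (j < N + C)%N && (N < j + C)%N].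
have le1 (j : 'I_N.*2) : `|f (node D M delta j)| <= if j \in A then B else 0.
  case: ifPn => //; rewrite inE negb_and -!leqNgt => jA.
  rewrite f0 ?normr0// /node normrM.
  rewrite (ger0_norm (_ : 0 <= delta / D%:R)) ?divr_ge0 ?(ltW d0)//.
  rewrite ler_wpM2r ?divr_ge0 ?(ltW d0)// ler_normr.
  by case/orP: jA; rewrite -(ler_nat R) natrD -/N => jA; apply/orP; [left|right]; lra.
apply: le_trans (ler_sum _ (fun j _ => le1 j)) _.
rewrite -big_mkcond/= sumr_const -[B *+ _]mulr_natr ler_wpM2l ?ler_nat//.
  exact: le_trans (fB 0).
rewrite cardE -(size_map val) -(size_iota (N - C) C.*2).
apply: uniq_leq_size; first by rewrite map_inj_uniq ?enum_uniq//; exact: val_inj.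
move=> k /mapP[j]; rewrite mem_enum inE mem_iota => /andP[h1 h2] ->.
by have := ltn_ord j; rewrite /=; lia.
Qed.

End Jackson.

(** * Composition of recursive functions of small arity *)

Section Recursive.
Local Open Scope nat_scope.
Variable k : nat.
Implicit Types f g h : k.-tuple nat -> nat.

Lemma recursive_comp1 (F : 1.-tuple nat -> nat) g :
  recursive F -> recursive g -> recursive (fun v => F [tuple g v]).
Proof.
move=> rF rg; have := @recursive_comp k 1 F (fun _ => g) rF (fun _ => rg).
congr recursive; apply/funext => v; congr F.
by apply: eq_from_tnth => i; rewrite tnth_mktuple (ord1 i).
Qed.

Lemma recursive_comp2 (F : 2.-tuple nat -> nat) f g :
  recursive F -> recursive f -> recursive g ->
  recursive (fun v => F [tuple f v; g v]).
Proof.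
move=> rF rf rg.
(* The indexed family of inner functions is read off a tuple of functions; the default of [nth] is
   never reached. *)
have := @recursive_comp k 2 F (fun i => tnth [tuple f; g] i) rF.
have ri (i : 'I_2) : recursive (tnth [tuple f; g] i).
  by case: i => -[|[|//]] Hi; rewrite (tnth_nth f).
move=> /(_ ri); congr recursive; apply/funext => v; congr F.
by apply: eq_from_tnth => -[[|[|//]] Hi]; rewrite tnth_mktuple !(tnth_nth f) (tnth_nth 0).
Qed.

Lemma recursive_comp3 (F : 3.-tuple nat -> nat) f g h :
  recursive F -> recursive f -> recursive g -> recursive h ->
  recursive (fun v => F [tuple f v; g v; h v]).
Proof.
move=> rF rf rg rh.
have := @recursive_comp k 3 F (fun i => tnth [tuple f; g; h] i) rF.
have ri (i : 'I_3) : recursive (tnth [tuple f; g; h] i).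
  by case: i => -[|[|[|//]]] Hi; rewrite (tnth_nth f).
move=> /(_ ri); congr recursive; apply/funext => v; congr F.
by apply: eq_from_tnth => -[[|[|[|//]]] Hi]; rewrite tnth_mktuple !(tnth_nth f) (tnth_nth 0).
Qed.

Lemma recursiveS g : recursive g -> recursive (fun v => (g v).+1).
Proof. exact: recursive_comp1 recursive_succ. Qed.

Lemma recursive_cst c : recursive (fun _ : k.-tuple nat => c).
Proof.
elim: c => [|c IH]; last exact: recursiveS.
by apply: (@recursive_comp k 0 _ (fun _ _ => 0) recursive_zero); case.
Qed.

End Recursive.

(** * Recursiveness of addition and of powers of two *)

Section RecursiveArithmetic.
Local Open Scope nat_scope.

Lemma recursive_addn2 : recursive (fun v : 2.-tuple nat => tnth v ord0 + tnth v ord_max).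
Proof.
(* In the recursion step position 0 holds the counter and position 1 the previous value. *)
apply: (@recursive_primrec 1 (fun v => tnth v ord0) (fun v => (tnth v (inord 1)).+1)).
- exact: recursive_proj.
- exact/recursiveS/recursive_proj.
- by move=> v; rewrite !(tnth_nth 0).
- by move=> n v; rewrite !(tnth_nth 0) /= inordK.
Qed.

Lemma recursive_double : recursive (fun v : 1.-tuple nat => (tnth v ord0).*2).
Proof.
apply: (@recursive_primrec 0 (fun=> 0) (fun v => (tnth v (inord 1)).+2)).
- exact: recursive_cst.
- exact/recursiveS/recursiveS/recursive_proj.
- by move=> v; rewrite !(tnth_nth 0).
- by move=> n v; rewrite !(tnth_nth 0) /= inordK.
Qed.

Lemma recursive_exp2 : recursive (fun v : 1.-tuple nat => 2 ^ tnth v ord0).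
Proof.
apply: (@recursive_primrec 0 (fun=> 1) (fun v => (tnth v (inord 1)).*2)).
- exact: recursive_cst.
- have := @recursive_comp1 2 _ (fun v => tnth v (inord 1)) recursive_double.
  by move=> /(_ (recursive_proj _)).
- by move=> v; rewrite !(tnth_nth 0).
- by move=> n v; rewrite !(tnth_nth 0) /= inordK//= expnS mul2n.
Qed.

Lemma recursiveD (k : nat) (f g : k.-tuple nat -> nat) :
  recursive f -> recursive g -> recursive (fun v => f v + g v).
Proof. by move=> rf rg; exact: recursive_comp2 recursive_addn2 rf rg. Qed.

Lemma recursive_expn2 (k : nat) (f : k.-tuple nat -> nat) :
  recursive f -> recursive (fun v => 2 ^ f v).
Proof. by move=> rf; exact: recursive_comp1 recursive_exp2 rf. Qed.

End RecursiveArithmetic.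

(** * From characteristic functions to integrals of test functions *)

Section IntegralComparison.
Local Open Scope classical_set_scope.
Local Open Scope ring_scope.
Variable R : realType.
Implicit Types mu nu : probability (measurableTypeR R) R.

Lemma integrable_bounded mu (f : R -> R) (B : R) :
  measurable_fun setT (f : measurableTypeR R -> R) -> (forall x, `|f x| <= B) ->
  mu.-integrable setT (EFin \o f).
Proof.
move=> mf fB; apply: measurable_bounded_integrable => //.
  by rewrite (le_lt_trans (probability_le1 _ _)) ?ltry.
exists B; split; first exact: num_real.
by move=> y By x _ /=; rewrite (le_trans (fB x)) ?ltW.
Qed.

Lemma integrable_cos mu (t b : R) :
  mu.-integrable setT (EFin \o (fun x : R => cos (t * x - b))).
Proof.
apply: (@integrable_bounded _ _ 1) => [|x]; last exact: cos_max.
apply: (measurableT_comp (continuous_measurable_fun (@continuous_cos R))).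
apply: measurable_funB => //; exact: measurable_funM.
Qed.

Lemma integrable_sin mu (t b : R) :
  mu.-integrable setT (EFin \o (fun x : R => sin (t * x - b))).
Proof.
apply: (@integrable_bounded _ _ 1) => [|x]; last exact: sin_max.
apply: (measurableT_comp (continuous_measurable_fun (@continuous_sin R))).
apply: measurable_funB => //; exact: measurable_funM.
Qed.

Lemma integrable_lincomb mu (I : Type) (s : seq I) (c : I -> R) (g : I -> R -> R) :
  (forall i, mu.-integrable setT (EFin \o g i)) ->
  mu.-integrable setT (EFin \o (fun x : R => \sum_(i <- s) c i * g i x)).
Proof.
move=> ig.
rewrite (_ : _ \o _ = (fun x => \sum_(i <- s) (c i * g i x)%:E)%E); last first.
  by apply/funext => x /=; rewrite sumEFin.
apply: integrable_sum => // i _.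
rewrite (_ : (fun x => _) = (fun x => (c i)%:E * (EFin \o g i) x)%E).
  exact: integrableZl.
by apply/funext => x /=; rewrite EFinM.
Qed.

Lemma Rintegral_lincomb mu (I : Type) (s : seq I) (c : I -> R) (g : I -> R -> R) :
  (forall i, mu.-integrable setT (EFin \o g i)) ->
  \int[mu]_x (\sum_(i <- s) c i * g i x) = \sum_(i <- s) c i * \int[mu]_x g i x.
Proof.
move=> ig; elim: s => [|i s IH].
  under eq_Rintegral do rewrite big_nil.
  by rewrite Rintegral_cst// mul0r big_nil.
under eq_Rintegral do rewrite big_cons.
rewrite RintegralD//; last 2 first.
- rewrite (_ : _ \o _ = (fun x => (c i)%:E * (EFin \o g i) x)%E).
    exact: integrableZl.
  by apply/funext => x /=; rewrite EFinM.
- exact: integrable_lincomb.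
by rewrite big_cons RintegralZl// IH.
Qed.

Lemma ler_norm_ReIm (z : R[i]) (e : R) : `|z| < e%:C%C ->
  `|complex.Re z| < e /\ `|complex.Im z| < e.
Proof.
case: z => a b; rewrite normc_def/= ltcE/= => /andP[_ h].
split; apply: le_lt_trans h; rewrite -sqrtr_sqr ler_sqrt ?addr_ge0 ?sqr_ge0//.
  by rewrite lerDl sqr_ge0.
by rewrite lerDr sqr_ge0.
Qed.

(** The addition formula splits the shifted cosine into the real and imaginary parts of the
    characteristic function, each costing [e]. *)
Lemma Rintegral_cos_dist mu nu (t b e : R) :
  `|char_fun mu t - char_fun nu t| < e%:C%C ->
  `|\int[mu]_x cos (t * x - b) - \int[nu]_x cos (t * x - b)| <= 2 * e.
Proof.
move=> /ler_norm_ReIm[]; rewrite /char_fun /cintegral/= => hc hs.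
have cosE (P : probability (measurableTypeR R) R) : \int[P]_x cos (t * x - b) =
    cos b * \int[P]_x cos (t * x) + sin b * \int[P]_x sin (t * x).
  have ic : P.-integrable setT (EFin \o (fun x : R => cos (t * x))).
    have := integrable_cos P t 0; congr (_.-integrable _ _).
    by apply/funext => x /=; rewrite subr0.
  have is_ : P.-integrable setT (EFin \o (fun x : R => sin (t * x))).
    have := integrable_sin P t 0; congr (_.-integrable _ _).
    by apply/funext => x /=; rewrite subr0.
  have zl (c : R) (g : R -> R) : P.-integrable setT (EFin \o g) ->
      P.-integrable setT (EFin \o (fun x : R => c * g x)).
    move=> ig; rewrite (_ : _ \o _ = (fun x => c%:E * (EFin \o g) x)%E).
      exact: integrableZl.
    by apply/funext => x /=; rewrite EFinM.
  under eq_Rintegral do rewrite cosB mulrC [sin _ * sin _]mulrC.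
  by rewrite RintegralD ?RintegralZl//; exact: zl.
rewrite !cosE.
set c1 := \int[mu]_x cos _ in hc *; set c2 := \int[nu]_x cos _ in hc *.
set s1 := \int[mu]_x sin _ in hs *; set s2 := \int[nu]_x sin _ in hs *.
have -> : cos b * c1 + sin b * s1 - (cos b * c2 + sin b * s2) =
  cos b * (c1 - c2) + sin b * (s1 - s2) by ring.
rewrite (le_trans (ler_normD _ _))// !normrM mulr_natl mulr2n lerD//.
- by rewrite -[e]mul1r ler_pM ?cos_max// ltW.
- by rewrite -[e]mul1r ler_pM ?sin_max// ltW.
Qed.

Lemma integrable_jackson mu (f : R -> R) (D M : nat) (delta : R) :
  (0 < D)%N -> (0 < M)%N -> 0 < delta ->
  mu.-integrable setT (EFin \o jackson f D M delta).
Proof.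
move=> D0 M0 d0; rewrite (_ : jackson f D M delta = fun x => \sum_(i : jackson_index (D * M))
    f (node D M delta i.1) / jackson_mass R (D * M) *
    cos (jackson_freq delta i * x - jackson_freq delta i * node D M delta i.1)).
  by apply: integrable_lincomb => i; exact: integrable_cos.
by apply/funext => x; rewrite jacksonE.
Qed.

(** Each cosine costs [2 e]. The [(D M)^4] frequencies at a node are absorbed by the mass, which is
    at least that number, leaving the sum of [|f|] over the nodes. *)
Lemma jackson_Rintegral_dist mu nu (f : R -> R) (D M C : nat) (delta B e : R) :
  (0 < D)%N -> (0 < M)%N -> 0 < delta -> (forall y, `|f y| <= B) ->
  (forall y, C%:R * (delta / D%:R) <= `|y| -> f y = 0) ->
  (forall t, `|t| <= 8 * D%:R / delta ->
    `|char_fun mu t - char_fun nu t| < e%:C%C) ->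
  `|\int[mu]_x jackson f D M delta x - \int[nu]_x jackson f D M delta x| <=
  B * (C.*2)%:R * (2 * e).
Proof.
move=> D0 M0 d0 fB f0 chf.
have N0 : (0 < D * M)%N by rewrite muln_gt0 D0.
have Z0 := jackson_mass_gt0 R N0.
(* The sign of [e] follows from the hypothesis on characteristic functions at [t = 0]. *)
have e0 : 0 <= 2 * e.
  have /chf/ler_norm_ReIm[h _] : `|0 : R| <= 8 * D%:R / delta.
    by rewrite normr0 divr_ge0 ?mulr_ge0 ?(ltW d0).
  by have := le_lt_trans (normr_ge0 _) h; lra.
under eq_Rintegral do rewrite jacksonE//.
under [X in _ - X]eq_Rintegral do rewrite jacksonE//.
rewrite !Rintegral_lincomb; try by move=> i; exact: integrable_cos.
rewrite -sumrB (le_trans (ler_norm_sum _ _ _))//.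
have le1 (i : jackson_index (D * M)) : `|f (node D M delta i.1) / jackson_mass R (D * M) *
      \int[mu]_x cos (jackson_freq delta i * x - jackson_freq delta i * node D M delta i.1) -
    f (node D M delta i.1) / jackson_mass R (D * M) *
      \int[nu]_x cos (jackson_freq delta i * x - jackson_freq delta i * node D M delta i.1)| <=
    `|f (node D M delta i.1)| * (2 * e / jackson_mass R (D * M)).
  rewrite -mulrBr !normrM normfV (gtr0_norm Z0) mulrAC -mulrA.
  rewrite ler_wpM2l// mulrC [_ / _]mulrC ler_wpM2l ?invr_ge0 ?(ltW Z0)//.
  by apply: Rintegral_cos_dist; apply: chf; exact: jackson_freq_le.
apply: le_trans (ler_sum _ (fun i _ => le1 i)) _.
rewrite -mulr_suml -(pair_bigA _ (fun j _ => `|f (node D M delta (j : 'I__))|))/=.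
under eq_bigr do rewrite sumr_const !card_prod card_ord -mulr_natr.
rewrite -mulr_suml -[X in X <= _]mulrA ler_pM ?sumr_ge0//.
- by rewrite mulr_ge0// divr_ge0// ltW.
- exact: sum_node_le.
rewrite mulrCA ler_piMr// ler_pdivrMr// mul1r.
by rewrite !natrM (le_trans _ (jackson_mass_ge R N0))// le_eqVlt; apply/orP; left; apply/eqP; ring.
Qed.

Lemma measurable_tail (c : R) : measurable ([set x | c < `|x|] : set (measurableTypeR R)).
Proof.
rewrite (_ : [set _ | _] = ~` `[- c, c]%classic).
  by apply: measurableC; exact: measurable_itv.
apply/seteqP; split => x /=; rewrite in_itv/= -ler_norml ltNge => /negP//.
Qed.

(** Continuity from above: the tail sets decrease to the empty set. *)
Lemma probability_tail mu (delta e : R) : 0 < delta -> 0 < e ->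
  \forall M \near \oo, fine (mu [set x : R | M%:R * delta < `|x|]) <= e.
Proof.
move=> d0 e0; pose A (M : nat) := [set x : measurableTypeR R | M%:R * delta < `|x|].
have mA M : measurable (A M) by exact: measurable_tail.
have capA : \bigcap_M A M = set0.
  rewrite -subset0 => x /(_ (Num.bound (`|x| / delta)) I); rewrite /A/=.
  rewrite -ltr_pdivlMr// => h; have := archi_boundP (divr_ge0 (normr_ge0 x) (ltW d0)).
  by move=> /(lt_trans h); rewrite ltxx.
have : mu \o A @ \oo --> (0 : R)%:E.
  have -> : (0 : R)%:E = mu (\bigcap_M A M) by rewrite capA measure0.
  apply: nonincreasing_cvg_mu => //.
  - by rewrite -ge0_fin_numE ?fin_num_measure.
  - by rewrite capA.
  - move=> m n mn; rewrite subsetEset => x; rewrite /A/=.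
    by apply: le_lt_trans; rewrite ler_wpM2r ?ler_nat// ltW.
move=> /fine_cvgP[_] /cvgr0_norm_le => /(_ e e0).
by apply: filterS => M /=; apply: le_trans; exact: ler_norm.
Qed.

(** The pointwise error bound applies on [-M delta, M delta]; beyond it [f] vanishes while the
    periodic approximant is still at most [B], hence the tail term. *)
Lemma Rintegral_jackson_error mu (f : R -> R) (D M : nat) (delta B L eta : R) :
  (0 < D)%N -> (0 < M)%N -> 0 < delta -> continuous f ->
  (forall y, `|f y| <= B) -> (forall y, L <= `|y| -> f y = 0) ->
  (forall y z, `|y - z| < delta -> `|f y - f z| <= eta) ->
  L <= M%:R * delta - delta ->
  `|\int[mu]_x f x - \int[mu]_x jackson f D M delta x| <=
  eta + 4 * B / D%:R ^+ 2 + B * fine (mu [set x : R | M%:R * delta < `|x|]).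
Proof.
move=> D0 M0 d0 cf fB f0 fmod LM.
set A := [set x : R | _]; set E := eta + _.
have mA : measurable (A : set (measurableTypeR R)) by exact: measurable_tail.
have E0 : 0 <= E.
  rewrite addr_ge0// ?(le_trans _ (fmod 0 0 _)) ?subrr ?normr0//.
  by rewrite divr_ge0 ?mulr_ge0 ?sqr_ge0// (le_trans _ (fB 0)).
have B0 : 0 <= B by rewrite (le_trans _ (fB 0)).
have iff_ : mu.-integrable setT (EFin \o f).
  by apply: integrable_bounded fB; exact: continuous_measurable_fun.
have ij := integrable_jackson mu f D0 M0 d0.
have icst : mu.-integrable setT (EFin \o (fun=> E : R)).
  by apply: (@integrable_bounded _ _ E) => // x; rewrite ger0_norm.
have iA : mu.-integrable setT (EFin \o (fun x : R => B * \1_A x)).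
  apply: (@integrable_bounded _ _ B) => [|x].
    by apply: measurable_funM => //; exact: measurable_indic.
  by rewrite normrM ger0_norm// ler_piMr// indicE; case: (x \in A); rewrite ?normr1 ?normr0.
have idiff : mu.-integrable setT (EFin \o (fun x => f x - jackson f D M delta x)).
  rewrite (_ : _ \o _ = (EFin \o f) \- (EFin \o jackson f D M delta))%E//.
  exact: integrableB.
rewrite -RintegralB// (le_trans (le_normr_Rintegral _ idiff))//.
have -> : B * fine (mu A) = \int[mu]_x (B * \1_A x).
  rewrite RintegralZl// /Rintegral ?integral_indic ?setIT//.
  apply: (@integrable_bounded _ _ 1) => [|x]; first exact: measurable_indic.
  by rewrite indicE; case: (x \in A); rewrite ?normr1 ?normr0.
have -> : E = \int[mu]_x E.
  transitivity (E * fine (1%E : \bar R)); first by rewrite mulr1.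
  by rewrite Rintegral_cst//; congr (_ * fine _); exact/esym/probability_setT.
rewrite -RintegralD//; apply: le_Rintegral => //.
- exact: integrable_norm.
- exact: (integrableD _ icst iA).
move=> x _; rewrite indicE; have [xA|xA] := boolP (x \in A); last first.
  rewrite mulr0 addr0; apply: jackson_error fB f0 fmod LM _ => //.
  by rewrite leNgt; apply: contra xA => xA; rewrite inE.
rewrite f0 ?sub0r ?normrN ?mulr1.
  by rewrite (le_trans (jackson_bound _ _ D0 M0 fB))// lerDr.
by move: xA; rewrite inE /A/= => h; lra.
Qed.

(** The bound does not mention [M], so [M] may be chosen after [mu] and [nu], making both tails cost
    less than an arbitrary slack [s]; no rate of decay of the tails enters. *)
Lemma Rintegral_dist_le mu nu (f : R -> R) (D C : nat) (delta B eta e : R) :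
  (0 < D)%N -> 0 < delta -> continuous f -> (forall y, `|f y| <= B) ->
  (forall y, C%:R * (delta / D%:R) <= `|y| -> f y = 0) ->
  (forall y z, `|y - z| < delta -> `|f y - f z| <= eta) ->
  (forall t, `|t| <= 8 * D%:R / delta ->
    `|char_fun mu t - char_fun nu t| < e%:C%C) ->
  `|\int[mu]_x f x - \int[nu]_x f x| <=
  2 * (eta + 4 * B / D%:R ^+ 2) + B * (C.*2)%:R * (2 * e).
Proof.
move=> D0 d0 cf fB f0 fmod chf.
have B0 : 0 <= B by rewrite (le_trans _ (fB 0)).
apply/ler_addgt0Pr => s s0.
(* Chosen so that [B * s' <= s / 2] for each measure; the [+ 1] keeps the denominator positive when
   [B = 0]. *)
pose s' := s / (2 * (B + 1)).
have s'0 : 0 < s' by rewrite divr_gt0// mulr_gt0// ltr_wpDl.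
have : \forall M \near \oo, [/\ (C < M)%N,
    fine (mu [set x : R | M%:R * delta < `|x|]) <= s' &
    fine (nu [set x : R | M%:R * delta < `|x|]) <= s'].
  by near=> M; split; near: M;
    [exact: nbhs_infty_gt|exact: probability_tail|exact: probability_tail].
move=> [M0 _ /(_ M0 (leqnn _))]; move: M0 => M [CM tmu tnu].
have M0 : (0 < M)%N by lia.
have LM : C%:R * (delta / D%:R) <= M%:R * delta - delta.
  have -> : M%:R * delta - delta = (M%:R - 1) * delta by ring.
  rewrite ler_pM ?divr_ge0 ?(ltW d0)//.
    by rewrite lerBrDr natr1 ler_nat.
  by rewrite ler_piMr ?(ltW d0)// invf_le1 ?ltr0n// ler1n.
have e1 := Rintegral_jackson_error mu D0 M0 d0 cf fB f0 fmod LM.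
have e2 := Rintegral_jackson_error nu D0 M0 d0 cf fB f0 fmod LM.
have e3 := jackson_Rintegral_dist D0 M0 d0 fB f0 chf.
have Bs : B * s' <= s / 2.
  rewrite /s' mulrA ler_pdivrMr ?mulr_gt0// ?ltr_wpDl//; nra.
have b1 := le_trans (ler_wpM2l B0 tmu) Bs; have b2 := le_trans (ler_wpM2l B0 tnu) Bs.
move: e1 e2 e3 b1 b2; rewrite !ler_norml; set J1 := Rintegral mu _ (jackson _ _ _ _).
set J2 := Rintegral nu _ (jackson _ _ _ _).
move=> /andP[? ?] /andP[? ?] /andP[? ?] ? ?; apply/andP; split; lra.
Unshelve. all: by end_near. Qed.

End IntegralComparison.

(** * Bounds and global moduli for compactly supported functions *)

Section CompactSupport.
Local Open Scope classical_set_scope.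
Local Open Scope ring_scope.
Variable R : realType.
Implicit Types (f : R -> R) (L : R).

(** Walking right in steps of length [s] changes [f] by at most 1 per step, and [m] steps lead from
    [-L] past [L], where [f] is 0. *)
Lemma bounded_of_unit_modulus f L (s : R) (m : nat) :
  (forall x y, `|x - y| <= s -> `|f x - f y| <= 1) -> 0 <= s ->
  (forall x, L <= `|x| -> f x = 0) -> 2 * L <= m%:R * s ->
  forall x, `|f x| <= m%:R.
Proof.
move=> fmod s0 f0 Lm.
have chain i x : L - i%:R * s <= x -> `|f x| <= i%:R.
  elim: i x => [|i IH] x; first by rewrite mul0r subr0 => Lx; rewrite f0 ?normr0// ler_normr Lx.
  rewrite -natr1 => Lx.
  have h1 : `|f (x + s)| <= i%:R by apply: IH; lra.
  have h2 : `|f x - f (x + s)| <= 1.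
    by apply: fmod; rewrite opprD addrA subrr sub0r normrN ger0_norm.
  by have := ler_normD (f x - f (x + s)) (f (x + s)); rewrite subrK; lra.
move=> x; have [Lx|Lx] := leP (- L) x; first by apply: chain; lra.
by rewrite f0 ?normr0// ler_normr; apply/orP; right; lra.
Qed.

Lemma expr2V_lt (e : R) : 0 < e -> exists k, 2 ^- k < e.
Proof.
move=> e0; exists (Num.bound e^-1).
have := archi_boundP (ltW (_ : 0 < e^-1)); rewrite invr_gt0 => /(_ e0) h.
rewrite invf_plt ?posrE ?exprn_gt0//.
by rewrite (lt_trans h)// -natrX ltr_nat ltn_expl.
Qed.

Lemma continuous_of_dyadic_modulus f (a : nat -> nat) :
  (forall k x y, `|x - y| < 2 ^- a k -> `|f x - f y| < 2 ^- k) -> continuous f.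
Proof.
move=> fmod x; apply/cvgrPdist_lt => e e0.
have [k ke] := expr2V_lt e0.
near=> y; apply: lt_trans ke; apply: fmod; near: y.
by apply/nbhs_ballP; exists (2 ^- a k) => //=; rewrite invr_gt0 exprn_gt0.
Unshelve. all: by end_near. Qed.

(** As [2^-a <= 1], a point close to [-L, L] stays in [-(L+1), L+1], where the local modulus
    applies; if both points are outside [-L, L], both values are 0. *)
Lemma modulus_of_compact_support f (L a k : nat) :
  (forall x y, `|x - y| < 2 ^- a -> `|x| <= L.+1%:R -> `|y| <= L.+1%:R ->
    `|f x - f y| < 2 ^- k) ->
  (forall x, L%:R <= `|x| -> f x = 0) ->
  forall x y, `|x - y| < 2 ^- a -> `|f x - f y| < 2 ^- k.
Proof.
move=> fmod f0.
have a1 : 2 ^- a <= 1 :> R by rewrite invf_le1 ?exprn_gt0// -natrX ler1n expn_gt0.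
have near_le (x y : R) : `|x - y| < 2 ^- a -> `|x| <= L%:R -> `|y| <= L.+1%:R.
  move=> xy xL; have := ler_normB x (x - y); rewrite subKr -natr1; lra.
move=> x y xy.
have [xL|xL] := leP `|x| L%:R.
  apply: fmod => //; last exact: near_le xy xL.
  by rewrite (le_trans xL)// ler_nat.
have [yL|yL] := leP `|y| L%:R.
  apply: fmod => //; last by rewrite (le_trans yL)// ler_nat.
  by apply: near_le yL; rewrite distrC.
by rewrite !f0 1?ltW// subrr normr0 invr_gt0 exprn_gt0.
Qed.

Lemma real_complex_expr2V k : (2 ^- k : R)%:C%C = 2 ^- k :> R[i].
Proof. by rewrite fmorphV rmorphXn/= rmorph_nat. Qed.

End CompactSupport.

(** * Explicit choice of parameters *)

Section EffectiveBound.
Variable R : realType.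
Implicit Types mu nu : probability (measurableTypeR R) R.

(* [f] is bounded by [2^b]; the modulus for [2^-(k+3)] is [2^-a], the mesh is
   [2^-(a+d)], with [d] making the Jackson error at most [2^-(k+3)]; [T] bounds
   the frequencies, and [J] absorbs the bound [2^b] and the number
   [2^(L+d+a+1)] of nodes in the support. *)
Lemma Rintegral_dist_lt mu nu (f : R -> R) (L k : nat) (a : nat -> nat) :
  let b := (L + a 0 + 2)%N in
  let d := (b + k + 5)%N in
  let T := (2 ^ (3 + d + a (k + 3)))%N in
  let J := (b + L + d + a (k + 3) + k + 5)%N in
  (forall j x y, `|x - y| < 2 ^- a j -> `|f x - f y| < 2 ^- j) ->
  (forall x, L%:R <= `|x| -> f x = 0) ->
  (forall t, `|t| <= T%:R -> `|char_fun mu t - char_fun nu t| < 2 ^- J) ->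
  `|\int[mu]_x f x - \int[nu]_x f x| < 2 ^- k.
Proof.
move=> b d T J fmod f0 chf.
have p0 n : 0 < 2 ^+ n :> R by rewrite exprn_gt0.
have fB x : `|f x| <= 2 ^+ b.
  (* The step is half of [2^-(a 0)], so that the non-strict distance bound gives the strict one;
     [L * 2^(a 0 + 2)] such steps have total length [2 L]. *)
  have := @bounded_of_unit_modulus R f L%:R (2 ^- (a 0).+1) (L * 2 ^ (a 0 + 2)) _ _ f0.
  move=> h; apply: le_trans (h _ _ _ x) _ => {h}.
  - move=> u v uv; have := @fmod 0 u v; rewrite expr0 invr1 => h; apply/ltW/h.
    rewrite (le_lt_trans uv)// ltf_pV2 ?posrE//.
    by rewrite exprS ltr_pMl// ltr1n.
  - by rewrite invr_ge0 ltW.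
  - rewrite natrM natrX -(addn1 (a 0)) !exprD le_eqVlt; apply/orP; left.
    by apply/eqP; field; rewrite (gt_eqF (p0 (a 0))).
  rewrite -natrX ler_nat /b -addnA [in leqRHS]expnD leq_mul2r ltnW ?orbT//.
  exact: ltn_expl.
have L2 : L%:R <= 2 ^+ L :> R by rewrite -natrX ler_nat ltnW// ltn_expl.
(* [C = 2^(L + d + a (k + 3))] intervals of mesh [2^-(a (k + 3) + d)] have total length [2^L], at
   least [L]. *)
have := @Rintegral_dist_le R mu nu f (2 ^ d) (2 ^ (L + d + a (k + 3)))
  (2 ^- a (k + 3)) (2 ^+ b) (2 ^- (k + 3)) (2 ^- J).
move=> /(_ _ _ (continuous_of_dyadic_modulus fmod) fB) h.
apply: le_lt_trans (h _ _ _ _ _) _ => {h}.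
- by rewrite expn_gt0.
- by rewrite invr_gt0.
- move=> y hy; apply: f0; apply: le_trans hy; apply: le_trans L2 _.
  rewrite !natrX !exprD le_eqVlt; apply/orP; left; apply/eqP.
  by field; rewrite ?gt_eqF.
- by move=> y z yz; apply/ltW/fmod.
- move=> t tT; rewrite real_complex_expr2V; apply: chf; apply: le_trans tT _.
  rewrite /T !natrX !exprD le_eqVlt; apply/orP; left; apply/eqP.
  by field; rewrite ?gt_eqF.
have -> : 2 ^+ b * (2 ^ (L + d + a (k + 3))).*2%:R * (2 * 2 ^- J) = 2 ^- (k + 3) :> R.
  rewrite -mul2n natrM natrX /J !exprD.
  by field; rewrite !gt_eqF// p0.
have Jle : 4 * 2 ^+ b / (2 ^ d)%:R ^+ 2 <= 2 ^- (k + 3) :> R.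
  rewrite natrX -exprM ler_pdivrMr// ler_pdivlMl//.
  have -> : 2 ^+ (k + 3) * (4 * 2 ^+ b) = 2 ^+ d :> R by rewrite /d !exprD; ring.
  by rewrite -!natrX ler_nat leq_exp2l//; lia.
(* Modulus and Jackson error count twice, once per measure, and the frequency term once: at most 5
   units of [2^-(k+3)], out of 8. *)
have -> : 2 ^- k = 8 * 2 ^- (k + 3) :> R.
  by rewrite exprD; field; rewrite gt_eqF.
by have : 0 < 2 ^- (k + 3) :> R; [rewrite invr_gt0|lra].
Qed.

End EffectiveBound.

Theorem theorem4p2 (R : realType)
    (phi_ : nat -> R -> R[i]) (phi : R -> R[i])
    (mu_ : nat -> probability (measurableTypeR R) R)
    (mu : probability (measurableTypeR R) R)
    (phi_E : forall (m : nat) (t : R), phi_ m t = char_fun (mu_ m) t)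
    (phiE : forall t : R, phi t = char_fun mu t)
    (phi_computable : computable_cfun_seq phi_)
    (phi_cvg : effective_cvg_cfun phi_ phi) :
  effective_cvg_distribution mu_ mu.
Proof.
have [alpha_phi ralpha_phi phi_cvgE] := phi_cvg.
move=> f [[_ [alpha ralpha fmod]] [Lf rLf f0]].
pose n_ (v : 2.-tuple nat) := tnth v ord0.
pose k_ (v : 2.-tuple nat) := tnth v ord_max.
pose L v := Lf [tuple n_ v].
(* The modulus is requested on [-(L+1), L+1], the margin required by
   [modulus_of_compact_support]. *)
pose a j v := alpha [tuple n_ v; (L v).+1; j v].
pose a0 := a (fun=> 0%N); pose a3 := a (fun v => k_ v + 3)%N.
pose b v := (L v + a0 v + 2)%N.
pose d v := (b v + k_ v + 5)%N.
pose T v := (2 ^ (3 + d v + a3 v))%N.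
pose J v := (b v + L v + d v + a3 v + k_ v + 5)%N.
have rn : recursive n_ by exact: recursive_proj.
have rk : recursive k_ by exact: recursive_proj.
have rL : recursive L by exact: recursive_comp1.
have ra j : recursive j -> recursive (a j).
  by move=> rj; apply: recursive_comp3 => //; exact: recursiveS.
have ra0 : recursive a0 by apply: ra; exact: recursive_cst.
have rc c : recursive (fun _ : 2.-tuple nat => c) by exact: recursive_cst.
have ra3 : recursive a3 by apply: ra; exact: recursiveD.
have rb : recursive b by do 2 apply: recursiveD => //.
have rd : recursive d by do 2 apply: recursiveD => //.
have rT : recursive T by apply: recursive_expn2; do 2 apply: recursiveD => //.
have rJ : recursive J by do 5 apply: recursiveD => //.
(* From this index on, the characteristic functions agree to precision [2^-J] on [-T, T], as the
   explicit bound demands. *)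
exists (fun v => alpha_phi [tuple T v; J v]); first exact: recursive_comp2.
move=> n k m nk_le_m; set v := [tuple n; k] in nk_le_m.
apply: (@Rintegral_dist_lt R _ _ _ (L v) k (fun j => alpha [tuple n; (L v).+1; j])).
- move=> j; apply: (modulus_of_compact_support (L := L v)); [exact: fmod|exact: f0].
- exact: f0.
- by move=> t tT; rewrite -phi_E -phiE; apply: (phi_cvgE (T v) (J v)).
Qed.
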